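(* Let $p$ be an odd prime, let $\alpha \ge \beta$ be positive integers, and let $G = \mathbb{Z}_{p^{\alpha}}\oplus\mathbb{Z}_{p^\beta}$. Let $A=\{a\in\mathbb{N} : 1\le a\le p^{\alpha},\ \gcd(a,p)=1\}$. Then $s_A(G) = p^{\alpha} + \alpha + \beta$.
   Context: $\mathbb{Z}_n$ denotes the cyclic group $\mathbb{Z}/n\mathbb{Z}$. A sequence over a finite abelian group $G$ (written additively) is a finite list of elements of $G$, repetitions allowed, order irrelevant; its length is its number of terms, and a subsequence is obtained by choosing a subset of the indices. For a set of integers $A$, a sequence $x_1\cdots x_k$ over $G$ is an $A$-weighted zero-sum sequence (of length $k$) if there exist $u_1,\dots,u_k\in A$ (not necessarily distinct) with $u_1x_1+\cdots+u_kx_k=0$ in $G$. If $G$ has exponent $n$, $s_A(G)$ is the smallest integer $\ell$ such that every sequence over $G$ of length at least $\ell$ has an $A$-weighted zero-sum subsequence of length exactly $n$. For $G=\mathbb{Z}_{p^\alpha}\oplus\mathbb{Z}_{p^\beta}$ with $\alpha\ge\beta$, the exponent is $p^\alpha$. *)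

(* Defs.v *)
From HB Require Import structures.
From mathcomp Require Import all_boot all_order all_algebra.
From mathcomp Require Import all_fingroup all_solvable.

Set Implicit Arguments.
Unset Strict Implicit.
Unset Printing Implicit Defensive.

Import GRing.Theory.
Local Open Scope ring_scope.

HB.instance Definition _ (U V : finZmodType) := GRing.Zmodule.on (U * V)%type.

Definition weighted_zero_sum (G : zmodType) (A : {pred int}) (s : seq G) : Prop :=
  exists u : 'I_(size s) -> int,
    (forall i, u i \in A) /\ \sum_(i < size s) s`_i *~ u i = 0.

(* [subseq] ranges over all choices of a subset of the indices of [s].
   [exponent] refers to the additive group underlying a [finZmodType]. *)
Definition has_weighted_zero_sum_subseq (G : finZmodType) (A : {pred int})
    (l : nat) : Prop :=
  forall s : seq G, (l <= size s)%N ->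
    exists t : seq G,
      [/\ subseq t s, size t = exponent [set: G] & weighted_zero_sum A t].

(* The constant need not exist (e.g. for empty [A]), so "s_A(G) = l" is a
   relation. *)
Definition is_s (G : finZmodType) (A : {pred int}) (l : nat) : Prop :=
  has_weighted_zero_sum_subseq G A l /\
  forall m : nat, has_weighted_zero_sum_subseq G A m -> (l <= m)%N.

Definition coprime_weights (p n : nat) : {pred int} :=
  [pred a : int | (1 <= a <= n%:Z) && coprimez a p].

(* Main.v *)
(** Upper bound, with [n = p ^ alpha] and [k = alpha + beta]: one proves, by
    induction on [k], that in an abelian group with two generators and order
    dividing [p ^ k] any [n + k] elements contain [n] that sum to zero with
    weights prime to [p].  In a cyclic group two terms prime to [p] suffice to
    solve the equation, and if there is at most one it is dropped and the others
    are divided by [p].  Otherwise reduce the coordinate vectors modulo [p].  If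
    some line of [F_p ^ 2] contains all of them but one, drop that one and pass
    to the subgroup of index [p] over the line.  If not, either there are two
    parallel nonzero vectors and two others off their line, or there are three
    pairwise nonparallel ones; in both cases Cramer's rule for two of them
    solves the equation modulo every power of [p], the other weights being
    chosen so that the two resulting ones are prime to [p].  This needs [n > 3];
    the remaining case [n = 3], [k = 2] is treated directly.

    Lower bound: [n - 1] zeros together with the elements [(p ^ i, 0)] for
    [i < alpha] and [(0, p ^ j)] for [j < beta]. *)

Require Import Defs.
From mathcomp Require Import all_boot all_order all_algebra.
From mathcomp Require Import all_fingroup all_solvable.
From mathcomp Require Import zify ring.

Set Implicit Arguments.
Unset Strict Implicit.
Unset Printing Implicit Defensive.

Import Order.TTheory GRing.Theory Num.Theory.
Local Open Scope ring_scope.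

(** The arguments below constrain only a few indices; this fills them up to exactly [n] terms. *)
Lemma subset_between (I : finType) (A J : {set I}) (n : nat) :
  A \subset J -> (#|A| <= n <= #|J|)%N ->
  exists T : {set I}, [/\ A \subset T, T \subset J & #|T| = n].
Proof.
move=> AJ /andP[]; elim: n => [|n IHn].
  by rewrite leqn0 cards_eq0 => /eqP-> _; exists set0; rewrite !sub0set cards0.
rewrite leq_eqVlt => /orP[/eqP cA _|An nJ]; first by exists A.
have [T [AT TJ cT]] := IHn An (ltnW nJ).
have /subsetPn[i iJ iT]: ~~ (J \subset T).
  by apply: contraL nJ => /subset_leq_card; rewrite cT -leqNgt.
exists (i |: T); split; last by rewrite cardsU1 iT cT.
  by rewrite (subset_trans AT) // subsetUr.
by rewrite subUset sub1set iJ.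
Qed.

(** * Integers prime to an odd prime [p] *)

Section UnitWeights.

Variables (p : nat) (p_pr : prime p) (p_odd : odd p).

Let p_gt2 : (2 < p)%N.
Proof. by rewrite odd_prime_gt2. Qed.

Lemma dvdz_primeM (m n : int) : (p %| m * n)%Z = (p %| m)%Z || (p %| n)%Z.
Proof. by rewrite !dvdzE abszM Euclid_dvdM. Qed.

Lemma dvdz_small (m : nat) : (0 < m < p)%N -> (p %| m%:Z)%Z = false.
Proof. by case/andP=> m_gt0 mp; rewrite dvdzE /= gtnNdvd. Qed.

Lemma dvdz_prime1 : (p %| 1)%Z = false.
Proof. by rewrite (dvdz_small (m := 1)) //; lia. Qed.

Lemma dvdz_prime2 : (p %| 2)%Z = false.
Proof. by rewrite (dvdz_small (m := 2)) //; lia. Qed.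

Lemma inverse_mod_pfactor (D : int) (k : nat) : ~~ (p %| D)%Z ->
  exists E m : int, ~~ (p %| E)%Z /\ E * D = 1 + m * p%:Z ^+ k.
Proof.
(* The exponent [k.+1] forces [E] to be prime to [p] even for [k = 0]. *)
move=> pD; have: coprimez D (p%:Z ^+ k.+1).
  by apply: coprimezXr; rewrite coprimez_sym coprimezE prime_coprime.
case/coprimezP=> -[E m] /= EDm; exists E, (- (m * p)); split; last first.
  by rewrite -EDm exprS; ring.
apply/negP=> pE; suff: (p %| (1 : int)%R)%Z by rewrite dvdz_prime1.
by rewrite -EDm rpredD ?(dvdz_mulr _ pE) // dvdz_mull // exprS dvdz_mulr.
Qed.

(** [r + c] and [r + 2 * c] differ by [c], so [w = 1] or [w = 2] works; [2] is prime to [p] because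
    [p] is odd. *)
Lemma unit_shift (r c : int) : ~~ (p %| c)%Z ->
  exists2 w : int, ~~ (p %| w)%Z & ~~ (p %| r + w * c)%Z.
Proof.
move=> pc; have [p1|p1] := boolP (p %| r + c)%Z; last first.
  by exists 1; rewrite ?dvdz_prime1 ?mul1r.
exists 2; first by rewrite dvdz_prime2.
apply: contra pc => p2; have -> : c = (r + 2 * c) - (r + c) by ring.
exact: rpredB.
Qed.

(** Each of the two sums excludes at most one residue class of [w], and [1], [2], [3] lie in
    distinct nonzero classes as [p > 3]. *)
Lemma unit_shift2 (r c s d : int) : (3 < p)%N ->
  ~~ (p %| c)%Z -> ~~ (p %| d)%Z ->
  exists w : int, [/\ ~~ (p %| w)%Z, ~~ (p %| r + w * c)%Z &
                      ~~ (p %| s + w * d)%Z].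
Proof.
move=> p_gt3 pc pd.
have uniq_bad (a b w w' : int) : ~~ (p %| b)%Z -> ~~ (p %| w - w')%Z ->
    (p %| a + w * b)%Z -> ~~ (p %| a + w' * b)%Z.
  move=> pb pw p1; apply/negP=> p2.
  have: (p %| (w - w') * b)%Z.
    have -> : (w - w') * b = (a + w * b) - (a + w' * b) by ring.
    exact: rpredB.
  by rewrite dvdz_primeM (negPf pw) (negPf pb).
have p3 : (p %| 3)%Z = false by rewrite (dvdz_small (m := 3)) //; lia.
have p1 := dvdz_prime1; have p2 := dvdz_prime2.
have n12 : ~~ (p %| (1 - 2 : int))%Z by rewrite (_ : 1 - 2 = -1) // rpredN p1.
have n13 : ~~ (p %| (1 - 3 : int))%Z by rewrite (_ : 1 - 3 = -2) // rpredN p2.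
have n23 : ~~ (p %| (2 - 3 : int))%Z by rewrite (_ : 2 - 3 = -1) // rpredN p1.
have [b1|b1] := boolP (p %| r + 1 * c)%Z; last first.
  have [b2|b2] := boolP (p %| s + 1 * d)%Z; last by exists 1; rewrite p1.
  have [b3|b3] := boolP (p %| r + 2 * c)%Z; last first.
    by exists 2; rewrite p2 b3 (uniq_bad _ _ 1).
  by exists 3; rewrite p3 (uniq_bad _ _ 2) // (uniq_bad _ _ 1).
have [b3|b3] := boolP (p %| s + 2 * d)%Z; last first.
  by exists 2; rewrite p2 b3 (uniq_bad _ _ 1).
by exists 3; rewrite p3 (uniq_bad _ _ 1) // (uniq_bad _ _ 2).
Qed.

(** * Weights at which linear functionals do not vanish modulo [p] *)

Definition unit_weights (I : finType) (u : I -> int) : Prop :=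
  forall i, ~~ (p %| u i)%Z.

Lemma unit_weights_update (I : finType) (u : I -> int) (l : I) (w : int) :
  unit_weights u -> ~~ (p %| w)%Z ->
  unit_weights (fun r => if r == l then w else u r).
Proof. by move=> uP wP r; case: ifP. Qed.

Lemma unit_weights1 (I : finType) : unit_weights (fun _ : I => 1).
Proof. by move=> i; rewrite dvdz_prime1. Qed.

Lemma sum_update (I : finType) (T : {set I}) (a u : I -> int) l w :
  l \in T ->
  \sum_(r in T) a r * (if r == l then w else u r) =
  \sum_(r in T) a r * u r + (w - u l) * a l.
Proof.
move=> lT; rewrite !(bigD1 l lT) /= eqxx.
rewrite [in LHS](eq_bigr (fun r => a r * u r)); first by ring.
by move=> r /andP[_ /negPf->].
Qed.

Lemma avoid_functional (I : finType) (T : {set I}) (a u : I -> int) l :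
  l \in T -> ~~ (p %| a l)%Z -> unit_weights u ->
  exists2 w, ~~ (p %| w)%Z &
    ~~ (p %| \sum_(r in T) a r * (if r == l then w else u r))%Z.
Proof.
move=> lT al uP.
have [w pw pS] := unit_shift (\sum_(r in T) a r * u r - u l * a l) al.
exists w => //; rewrite sum_update //.
by rewrite mulrBl [w * _ - _]addrC addrA.
Qed.

(** The weight at [l] repairs the first functional, then the weight at [k] the second. As [p]
    divides [a k], the second change does not affect the first functional modulo [p]. *)
Lemma avoid_two_functionals_separated (I : finType) (T : {set I})
    (a b : I -> int) k l :
  k \in T -> l \in T -> (p %| a k)%Z -> ~~ (p %| a l)%Z -> ~~ (p %| b k)%Z ->
  exists u : I -> int, [/\ unit_weights u,
    ~~ (p %| \sum_(r in T) a r * u r)%Z & ~~ (p %| \sum_(r in T) b r * u r)%Z].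
Proof.
move=> kT lT ak al bk.
have [w pw aw] := avoid_functional lT al (@unit_weights1 I).
set u := fun r => if r == l then w else 1.
have uP : unit_weights u by apply: unit_weights_update => //; apply: unit_weights1.
have [w' pw' bw] := avoid_functional kT bk uP.
exists (fun r => if r == k then w' else u r).
split=> //; first exact: unit_weights_update.
by rewrite sum_update // rpredDr // dvdz_mull.
Qed.

(** A single weight, at [l], has to serve both functionals; hence [unit_shift2] and [p > 3]. *)
Lemma avoid_two_functionals (I : finType) (T : {set I}) (a b : I -> int) l :
  (3 < p)%N -> l \in T -> ~~ (p %| a l)%Z -> ~~ (p %| b l)%Z ->
  exists u : I -> int, [/\ unit_weights u,
    ~~ (p %| \sum_(r in T) a r * u r)%Z & ~~ (p %| \sum_(r in T) b r * u r)%Z].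
Proof.
move=> p_gt3 lT al bl.
pose S (a : I -> int) := \sum_(r in T) a r * 1 - 1 * a l.
have [w [pw aw bw]] := unit_shift2 (S a) (S b) p_gt3 al bl.
exists (fun r => if r == l then w else 1); split.
- by apply: unit_weights_update => //; apply: unit_weights1.
- by rewrite sum_update // mulrBl [w * _ - _]addrC addrA.
- by rewrite sum_update // mulrBl [w * _ - _]addrC addrA.
Qed.

(** * Weighted zero sums over index sets; cyclic groups *)

(** The weights range over all integers prime to [p]; only [weighted_zero_subseq] brings them into a
    bounded interval. *)
Definition weighted_zero (I : finType) (G : zmodType) (T : {set I})
    (v : I -> G) : Prop :=
  exists2 u : I -> int, unit_weights u & \sum_(i in T) v i *~ u i = 0.

Lemma eq_weighted_zero (I : finType) (G : zmodType) (T : {set I})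
    (v w : I -> G) :
  {in T, v =1 w} -> weighted_zero T v -> weighted_zero T w.
Proof.
move=> vw [u uP u0]; exists u => //; rewrite -[RHS]u0.
by apply: eq_bigr => i iT; rewrite vw.
Qed.

Lemma mulrz_dvd_eq0 (G : zmodType) (f : G) (d m : int) :
  f *~ d = 0 -> (d %| m)%Z -> f *~ m = 0.
Proof. by move=> fd /dvdzP[q ->]; rewrite mulrC mulrzA fd mul0rz. Qed.

(** The equation is solved for the weight of [j], using an inverse [E] of [x j]. The solution is
    prime to [p] if the rest [S] of the sum is, and the weight of [i] is chosen to ensure this. *)
Lemma cyclic_weighted_zero_mod (I : finType) (T : {set I})
    (k : nat) (x : I -> int) i j :
  i \in T -> j \in T -> i != j ->
  ~~ (p %| x i)%Z -> ~~ (p %| x j)%Z ->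
  exists2 u : I -> int, unit_weights u &
    (p%:Z ^+ k.+1 %| \sum_(r in T) x r * u r)%Z.
Proof.
move=> iT jT ij xi xj; set P := p%:Z ^+ k.+1.
have [E [m [pE Em]]] := inverse_mod_pfactor k.+1 xj.
have iT' : i \in T :\ j by rewrite !inE ij.
have [w pw pS] := avoid_functional iT' xi (@unit_weights1 I).
pose u r : int := if r == i then w else 1.
have uP : unit_weights u by apply: unit_weights_update => //; apply: unit_weights1.
set S := \sum_(r in T :\ j) x r * u r; have {}pS : ~~ (p %| S)%Z := pS.
exists (fun r => if r == j then - (E * S) else u r).
  by apply: unit_weights_update => //; rewrite rpredN dvdz_primeM negb_or pE.
rewrite (bigD1 j) //= eqxx.
rewrite (_ : \sum_(r in T | _) _ = S); last first.
  rewrite /S; apply: eq_big => r; first by rewrite !inE andbC.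
  by move=> /andP[_ /negPf->].
have -> : x j * - (E * S) + S = (1 - E * x j) * S by ring.
by rewrite Em opprD addNKr -mulNr mulrAC dvdz_mull.
Qed.

Lemma cyclic_case (I : finType) (G : zmodType) (n k : nat) (f : G)
    (x : I -> int) (J : {set I}) :
  (1 < n)%N -> f *~ (p%:Z ^+ k) = 0 -> (n + k <= #|J|)%N ->
  exists T : {set I},
    [/\ T \subset J, #|T| = n & weighted_zero T (fun i => f *~ x i)].
Proof.
move=> n_gt1; elim: k f x J => [|k IHk] f x J fk nJ.
  have [|T [_ TJ cT]] := @subset_between I set0 J n (sub0set _).
    by rewrite cards0 -[n]addn0.
  exists T; split=> //; exists (fun=> 1); first exact: unit_weights1.
  by apply: big1 => i _; rewrite -[f]mulr1z fk !mul0rz.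
pose U := [set i in J | ~~ (p %| x i)%Z].
have UJ : U \subset J by apply/subsetP => i; rewrite inE => /andP[].
have [/card_gt1P[i [j [iU jU ij]]]|U1] := ltnP 1 #|U|.
  have AJ : [set r in [:: i; j]] \subset J.
    by apply/subsetP=> r; rewrite !inE => /orP[]/eqP->; apply: (subsetP UJ).
  have [|T [AT TJ cT]] := subset_between (n := n) AJ.
    by rewrite cardsE (leq_trans (card_size _)) // (leq_trans _ nJ) // leq_addr.
  have iT : i \in T by rewrite (subsetP AT) // !inE eqxx.
  have jT : j \in T by rewrite (subsetP AT) // !inE eqxx orbT.
  move: iU jU; rewrite !inE => /andP[_ xi] /andP[_ xj].
  have [u uP pu] := cyclic_weighted_zero_mod k iT jT ij xi xj.
  exists T; split=> //; exists u => //.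
  under eq_bigr do rewrite -mulrzA.
  by rewrite -mulrz_sumr (mulrz_dvd_eq0 fk).
(* At most one index lies in [U]. Off [U] a factor [p] moves from [x] to the generator, and [p ^ k]
   kills the new generator. *)
have [||T [TJ cT wT]] := IHk (f *~ p) (fun i => x i %/ p)%Z (J :\: U).
- by rewrite -mulrzA -exprS.
- by move: nJ; rewrite -(cardsID U J) (setIidPr UJ); lia.
exists T; split=> //; first exact: (subset_trans TJ (subsetDl _ _)).
apply: eq_weighted_zero wT => i /(subsetP TJ).
rewrite !inE negb_and => /andP[/orP[/negPf->//|]].
by rewrite negbK => /divzK px _; rewrite -mulrzA mulrC px.
Qed.

(** * Parallel vectors in the plane over F_p *)

(** The determinant of the vectors of [r] and [s]; divisibility by [p] means that they are parallel
    modulo [p]. *)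
Definition cross (I : Type) (x y : I -> int) (r s : I) : int :=
  x r * y s - y r * x s.

Lemma cross_sym (I : Type) (x y : I -> int) r s :
  cross x y r s = - cross x y s r.
Proof. by rewrite /cross; ring. Qed.

Lemma cross_dvd_sym (I : Type) (x y : I -> int) r s :
  (p %| cross x y r s)%Z = (p %| cross x y s r)%Z.
Proof. by rewrite cross_sym rpredN. Qed.

Lemma cross_neq (I : eqType) (x y : I -> int) r s :
  ~~ (p %| cross x y r s)%Z -> r != s.
Proof. by apply: contraNneq => ->; rewrite /cross mulrC subrr. Qed.

Definition nonzero_mod (I : Type) (x y : I -> int) (r : I) : bool :=
  ~~ ((p %| x r)%Z && (p %| y r)%Z).

Lemma nonzero_cross (I : Type) (x y : I -> int) r s :
  ~~ (p %| cross x y r s)%Z -> nonzero_mod x y r.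
Proof.
by apply: contraNN => /andP[px py]; rewrite /cross rpredB // dvdz_mulr.
Qed.

(** The vectors of [i] and [j] span the plane modulo [p], so a vector parallel to both is zero; the
    two identities make this explicit. *)
Lemma cross_parallel (I : Type) (x y : I -> int) i j k :
  nonzero_mod x y k -> (p %| cross x y k i)%Z -> ~~ (p %| cross x y j i)%Z ->
  ~~ (p %| cross x y k j)%Z.
Proof.
move=> nzk ki ji; apply: contraNN nzk => kj.
have xk : (p %| x k * cross x y j i)%Z.
  have -> : x k * cross x y j i = x j * cross x y k i - x i * cross x y k j.
    by rewrite /cross; ring.
  by rewrite rpredB // dvdz_mull.
have yk : (p %| y k * cross x y j i)%Z.
  have -> : y k * cross x y j i = y j * cross x y k i - y i * cross x y k j.
    by rewrite /cross; ring.
  by rewrite rpredB // dvdz_mull.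
by move: xk yk; rewrite !dvdz_primeM (negPf ji) !orbF => -> ->.
Qed.

(** * Solving both coordinates at once *)

Definition sum_zero_mod (I : finType) (P : int) (x y : I -> int)
    (T : {set I}) : Prop :=
  exists u : I -> int, [/\ unit_weights u,
    (P %| \sum_(r in T) x r * u r)%Z & (P %| \sum_(r in T) y r * u r)%Z].

Lemma sum_zero_mod_weighted_zero (I : finType) (G : zmodType) (P : int)
    (f g : G) (x y : I -> int) (T : {set I}) :
  f *~ P = 0 -> g *~ P = 0 -> sum_zero_mod P x y T ->
  weighted_zero T (fun r => f *~ x r + g *~ y r).
Proof.
move=> fP gP [u [uP xu yu]]; exists u => //.
under eq_bigr do rewrite mulrzDl -!mulrzA.
by rewrite big_split /= -!mulrz_sumr (mulrz_dvd_eq0 fP) // (mulrz_dvd_eq0 gP) ?addr0.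
Qed.

Lemma sum_cross (I : finType) (x y u : I -> int) (T : {set I}) s :
  \sum_(r in T) cross x y r s * u r =
  (\sum_(r in T) x r * u r) * y s - (\sum_(r in T) y r * u r) * x s.
Proof.
rewrite !mulr_suml -sumrB; apply: eq_bigr => r _; rewrite /cross; ring.
Qed.

(* Cramer's rule gives the weights of [i] and [j]; up to a unit they are the
   cross products of the remaining sum with the vectors [j] and [i]. *)
Lemma cramer (I : finType) (k : nat) (x y u : I -> int) (T : {set I}) i j :
  i \in T -> j \in T -> ~~ (p %| cross x y i j)%Z -> unit_weights u ->
  ~~ (p %| \sum_(r in T :\ i :\ j) cross x y r i * u r)%Z ->
  ~~ (p %| \sum_(r in T :\ i :\ j) cross x y r j * u r)%Z ->
  sum_zero_mod (p%:Z ^+ k.+1) x y T.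
Proof.
move=> iT jT cij uP; rewrite !sum_cross.
set X := \sum_(r in _) x r * _; set Y := \sum_(r in _) y r * _ => Ci Cj.
have ji : j != i by rewrite eq_sym (cross_neq cij).
set P := p%:Z ^+ k.+1.
have [E [m [pE Em]]] := inverse_mod_pfactor k.+1 cij.
pose ui := - (E * (X * y j - Y * x j)); pose uj := E * (X * y i - Y * x i).
pose u' r := if r == j then uj else if r == i then ui else u r.
have sum_u' (z : I -> int) : \sum_(r in T) z r * u' r =
    z i * ui + z j * uj + \sum_(r in T :\ i :\ j) z r * u r.
  have jTi : j \in T :\ i by rewrite !inE ji.
  rewrite (big_setD1 i) //= (big_setD1 j) //= addrA /u' eqxx eq_sym (negPf ji).
  rewrite !eqxx; congr (_ + _); apply: eq_bigr => r.
  by rewrite !inE => /and3P[/negPf-> /negPf->].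
exists u'; split.
- apply: unit_weights_update; last by rewrite dvdz_primeM negb_or pE.
  by apply: unit_weights_update => //; rewrite rpredN dvdz_primeM negb_or pE.
- rewrite sum_u' -/X.
  have -> : x i * ui + x j * uj + X = (1 - E * cross x y i j) * X.
    by rewrite /ui /uj /cross; ring.
  by rewrite Em opprD addNKr -mulNr mulrAC dvdz_mull.
- rewrite sum_u' -/Y.
  have -> : y i * ui + y j * uj + Y = (1 - E * cross x y i j) * Y.
    by rewrite /ui /uj /cross; ring.
  by rewrite Em opprD addNKr -mulNr mulrAC dvdz_mull.
Qed.

(** Cramer's rule is applied to [i] and [j]. The index [k] separates the two functionals, its cross
    product vanishing with [i] but not with [j]; [l] makes the one for [i] nonzero. Four indices
    need [n > 3]. *)
Lemma parallel_pair_case (I : finType) (n m : nat) (x y : I -> int)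
    (J : {set I}) i j k l :
  (3 < n <= #|J|)%N -> i \in J -> j \in J -> k \in J -> l \in J ->
  i != k -> j != l -> nonzero_mod x y k -> (p %| cross x y k i)%Z ->
  ~~ (p %| cross x y j i)%Z -> ~~ (p %| cross x y l i)%Z ->
  exists T : {set I},
    [/\ T \subset J, #|T| = n & sum_zero_mod (p%:Z ^+ m.+1) x y T].
Proof.
move=> /andP[n_gt3 nJ] iJ jJ kJ lJ ik jl nzk ki ji li.
have kj := cross_parallel nzk ki ji.
have AJ : [set r in [:: i; j; k; l]] \subset J.
  by apply/subsetP=> r; rewrite !inE => /or4P[]/eqP->.
have [|T [AT TJ cT]] := subset_between (n := n) AJ.
  by rewrite cardsE (leq_trans (card_size _)).
have inT r : r \in [:: i; j; k; l] -> r \in T.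
  by move=> rA; rewrite (subsetP AT) // inE.
have kT : k \in T :\ i :\ j.
  by rewrite !in_setD1 (cross_neq kj) eq_sym ik inT ?inE ?eqxx ?orbT.
have lT : l \in T :\ i :\ j.
  by rewrite !in_setD1 (cross_neq li) eq_sym jl inT ?inE ?eqxx ?orbT.
have [u [uP ui uj]] := @avoid_two_functionals_separated _ _
  (fun r => cross x y r i) (fun r => cross x y r j) k l kT lT ki li kj.
exists T; split=> //; apply: (cramer (i := i) (j := j) m _ _ _ uP ui uj).
- by rewrite inT ?inE ?eqxx ?orbT.
- by rewrite inT ?inE ?eqxx ?orbT.
- by rewrite cross_dvd_sym.
Qed.

(** With all weights [1], the sum over the indices other than [i] and [j] is congruent to the vector
    of [l], which is parallel to neither. This covers [p = 3] too. *)
Lemma three_directions_zero (I : finType) (m : nat) (x y : I -> int)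
    (T : {set I}) i j l :
  i \in T -> j \in T -> l \in T -> ~~ (p %| cross x y i j)%Z ->
  ~~ (p %| cross x y l i)%Z -> ~~ (p %| cross x y l j)%Z ->
  (forall r, r \in T -> r \notin [:: i; j; l] -> ~~ nonzero_mod x y r) ->
  sum_zero_mod (p%:Z ^+ m.+1) x y T.
Proof.
move=> iT jT lT ij li lj zero.
have lT' : l \in T :\ i :\ j.
  by rewrite !in_setD1 lT (cross_neq li) (cross_neq lj).
have avoid s : ~~ (p %| cross x y l s)%Z ->
    ~~ (p %| \sum_(r in T :\ i :\ j) cross x y r s * 1)%Z.
  move=> ls; rewrite (bigD1 l) //= mulr1 rpredDr //.
  apply: rpred_sum => r; rewrite !inE => /andP[/and3P[rj ri rT] rl].
  have := zero r rT; rewrite !inE !negb_or rj ri rl negbK => /(_ isT)/andP[xr yr].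
  by rewrite mulr1 /cross rpredB // dvdz_mulr.
exact: (cramer (i := i) (j := j) m iT jT ij (@unit_weights1 I)
          (avoid _ li) (avoid _ lj)).
Qed.

Lemma three_directions (I : finType) (m : nat) (x y : I -> int)
    (T : {set I}) i j l :
  (3 < p)%N ->
  i \in T -> j \in T -> l \in T -> ~~ (p %| cross x y i j)%Z ->
  ~~ (p %| cross x y l i)%Z -> ~~ (p %| cross x y l j)%Z ->
  sum_zero_mod (p%:Z ^+ m.+1) x y T.
Proof.
move=> p_gt3 iT jT lT ij li lj.
have lT' : l \in T :\ i :\ j.
  by rewrite !in_setD1 lT (cross_neq li) (cross_neq lj).
have [u [uP ui uj]] := @avoid_two_functionals _ _
  (fun r => cross x y r i) (fun r => cross x y r j) l p_gt3 lT' li lj.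
exact: (cramer (i := i) (j := j) m iT jT ij uP ui uj).
Qed.

(** Directions are points of the projective line over F_p, which has [p + 1] points; [None] encodes
    the vertical one. *)
Lemma card_pairwise_nonparallel (I : finType) (x y : I -> int) (U : {set I}) :
  {in U &, forall r s, r != s -> ~~ (p %| cross x y r s)%Z} -> (#|U| <= p.+1)%N.
Proof.
move=> Unp; have dvdF := dvdz_pcharf (pchar_Fp p_pr).
pose slope r : option 'F_p :=
  if (x r)%:~R == 0 :> 'F_p then None else Some ((y r)%:~R / (x r)%:~R).
have slope_inj : {in U &, injective slope}.
  move=> r s rU sU; rewrite /slope => rs; apply: contraTeq isT => /(Unp _ _ rU sU).
  rewrite dvdF /cross rmorphB !rmorphM /=.
  move: rs; case: eqP => [->|/eqP xr]; case: eqP => [->|/eqP xs] //.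
    by rewrite mul0r mulr0 subrr eqxx.
  move=> /(congr1 (odflt 0))/= /eqP.
  by rewrite eqr_div // mulrC => /eqP->; rewrite mulrC subrr eqxx.
by have := leq_card_in _ _ slope_inj; rewrite card_option card_Fp.
Qed.

Lemma card_set3 (I : finType) (i j l : I) :
  i != j -> l != i -> l != j -> #|[set r in [:: i; j; l]]| = 3.
Proof.
move=> ij li lj; rewrite cardsE (card_uniqP _) //= !inE.
by rewrite negb_or ij eq_sym li eq_sym lj.
Qed.

(** For [p > 3] any [n] indices including [i], [j], [l] will do. For [p = 3] there are four
    directions, so at most four vectors are nonzero modulo [p]; at least [n - 2] vanish and can fill
    up the triple. *)
Lemma nonparallel_case (I : finType) (n m : nat) (x y : I -> int)
    (J : {set I}) i j l :
  (2 < n)%N -> (n + 2 <= #|J|)%N -> i \in J -> j \in J -> l \in J ->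
  ~~ (p %| cross x y i j)%Z -> ~~ (p %| cross x y l i)%Z ->
  ~~ (p %| cross x y l j)%Z ->
  {in J &, forall r s, r != s -> nonzero_mod x y r -> nonzero_mod x y s ->
     ~~ (p %| cross x y r s)%Z} ->
  exists T : {set I},
    [/\ T \subset J, #|T| = n & sum_zero_mod (p%:Z ^+ m.+1) x y T].
Proof.
move=> n_gt2 nJ iJ jJ lJ ij li lj Jnp.
have cA := card_set3 (cross_neq ij) (cross_neq li) (cross_neq lj).
set A := [set r in _] in cA.
have AJ : A \subset J by apply/subsetP=> r; rewrite !inE => /or3P[]/eqP->.
have [iA jA lA] : [/\ i \in A, j \in A & l \in A].
  by split; rewrite inE !inE eqxx ?orbT.
have [p_gt3|p_le3] := ltnP 3 p.
  have [|T [/subsetP AT TJ cT]] := subset_between (n := n) AJ.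
    by rewrite cA; lia.
  exists T; split=> //.
  exact: (three_directions m p_gt3 (AT _ iA) (AT _ jA) (AT _ lA)).
pose U := [set r in J | nonzero_mod x y r].
have cU : (#|U| <= 4)%N.
  apply: leq_trans (_ : p.+1 <= _)%N => //.
  apply: (@card_pairwise_nonparallel _ x y) => r s.
  by rewrite !inE => /andP[rJ nzr] /andP[sJ nzs] rs; apply: Jnp.
have UJ : U \subset J by apply/subsetP=> r; rewrite inE => /andP[].
have AU : A \subset U.
  apply/subsetP=> r rA; rewrite inE (subsetP AJ) //=.
  move: rA; rewrite !inE => /or3P[]/eqP->; apply: nonzero_cross; try eassumption.
  by rewrite cross_dvd_sym; eassumption.
have [||T [/subsetP AT TZ cT]] := @subset_between I A (A :|: J :\: U) n.
- exact: subsetUl.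
- have AZ : A :&: (J :\: U) = set0.
    apply/setP=> r; rewrite in_setI in_setD in_set0.
    by have [/(subsetP AU)->|] := boolP (r \in A).
  rewrite cA n_gt2 cardsU AZ cards0 subn0 cA.
  by move: nJ; rewrite -(cardsID U J) (setIidPr UJ); lia.
exists T; split=> //.
  by rewrite (subset_trans TZ) // subUset AJ subsetDl.
apply: (three_directions_zero m (AT _ iA) (AT _ jA) (AT _ lA)) => //.
move=> r /(subsetP TZ); rewrite in_setU in_setD => /orP[|/andP[]].
  by rewrite !inE => ->.
by rewrite inE negb_and => /orP[/negPf->|].
Qed.

(** On a common line with [x i] prime to [p], the first coordinate determines the second modulo [p],
    so only one equation has to be solved. Swapping the coordinates gives the other case. *)
Lemma collinear_case (I : finType) (x y : I -> int) (T : {set I}) i k :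
  i \in T -> k \in T -> i != k -> nonzero_mod x y i -> nonzero_mod x y k ->
  (forall r, r \in T -> (p %| cross x y r i)%Z) -> sum_zero_mod p x y T.
Proof.
wlog xi : x y / ~~ (p %| x i)%Z => [hwlog|].
  move=> iT kT ik nzi nzk Ti.
  have [xi|/hwlog] := boolP (p %| x i)%Z; last by apply.
  have nz_swap r : nonzero_mod y x r = nonzero_mod x y r.
    by rewrite /nonzero_mod andbC.
  have [||||||r /Ti|u [uP yu xu]] := hwlog y x; rewrite ?nz_swap //.
  - by move: nzi; rewrite /nonzero_mod xi.
  - by rewrite -rpredN /cross opprB ![y _ * _]mulrC.
  - by exists u.
move=> iT kT ik nzi nzk Ti.
have xk : ~~ (p %| x k)%Z.
  apply: contraNN nzk => xk; rewrite xk /=.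
  have : (p %| y k * x i)%Z.
    have -> : y k * x i = x k * y i - cross x y k i by rewrite /cross; ring.
    by rewrite rpredB ?Ti ?dvdz_mulr.
  by rewrite dvdz_primeM (negPf xi) orbF.
have [u uP xu] := cyclic_weighted_zero_mod 0 iT kT ik xi xk.
exists u; split=> //.
have: (p %| (\sum_(r in T) y r * u r) * x i)%Z.
  have -> : (\sum_(r in T) y r * u r) * x i =
      (\sum_(r in T) x r * u r) * y i - \sum_(r in T) cross x y r i * u r.
    by rewrite sum_cross; ring.
  rewrite rpredB ?dvdz_mulr //; apply: rpred_sum => r rT.
  by rewrite dvdz_mulr ?Ti.
by rewrite dvdz_primeM (negPf xi) orbF.
Qed.

(** A third vector on the line of [i] and [k] gives a collinear triple. Otherwise take three further
    vectors: two of them are nonparallel and form three directions with [i], or all three are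
    parallel. *)
Lemma parallel_pair_case3 (I : finType) (x y : I -> int) (J : {set I}) i k :
  (4 < #|J|)%N -> i \in J -> k \in J -> i != k ->
  nonzero_mod x y i -> nonzero_mod x y k -> (p %| cross x y k i)%Z ->
  exists T : {set I}, [/\ T \subset J, #|T| = 3 & sum_zero_mod p x y T].
Proof.
move=> cJ iJ kJ ik nzi nzk ki.
have sub3 a b c : a \in J -> b \in J -> c \in J ->
    [set r in [:: a; b; c]] \subset J.
  by move=> aJ bJ cJ'; apply/subsetP=> r; rewrite !inE => /or3P[]/eqP->.
have kJi : k \in J :\ i by rewrite !inE eq_sym ik.
have cJ2 : (2 < #|J :\ i :\ k|)%N.
  by move: cJ; rewrite (cardsD1 i) iJ (cardsD1 k (J :\ i)) kJi; lia.
have [/existsP[r /andP[]]|] := boolP [exists r in J :\ i :\ k, p %| cross x y r i]%Z.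
  rewrite !inE => /and3P[rk ri rJ] pri.
  exists [set s in [:: i; k; r]]; split; [exact: sub3|exact: card_set3|].
  apply: (collinear_case (i := i) (k := k)); rewrite ?inE ?eqxx ?orbT //.
  by move=> s; rewrite !inE => /or3P[]/eqP->//; rewrite /cross mulrC subrr.
move=> /existsPn off.
have {}off r : r \in J :\ i :\ k -> ~~ (p %| cross x y r i)%Z.
  by have := off r; rewrite negb_and => /orP[/negPf->|].
have off_pair a b : a \in J :\ i :\ k -> b \in J :\ i :\ k ->
    ~~ (p %| cross x y b a)%Z ->
    exists T : {set I}, [/\ T \subset J, #|T| = 3 & sum_zero_mod p x y T].
  move=> aJ bJ ba; have [ai bi] := (off a aJ, off b bJ).
  move: aJ bJ; rewrite !inE => /and3P[_ _ aJ] /and3P[_ _ bJ].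
  have ia : ~~ (p %| cross x y i a)%Z by rewrite cross_dvd_sym.
  exists [set s in [:: i; a; b]]; split; first exact: sub3.
    by rewrite card_set3 ?(cross_neq ia) ?(cross_neq bi) ?(cross_neq ba).
  apply: (three_directions_zero (i := i) (j := a) (l := b) 0);
    rewrite ?inE ?eqxx ?orbT //.
  by move=> r; rewrite inE => ->.
have [a [b [c [[aJ bJ cJ'] [ab bc ca]]]]] := card_gt2P cJ2.
have [ba|] := boolP (p %| cross x y b a)%Z; last exact: off_pair.
have [ca'|] := boolP (p %| cross x y c a)%Z; last exact: off_pair.
have nz r : r \in J :\ i :\ k -> nonzero_mod x y r.
  by move=> /off; apply: nonzero_cross.
exists [set s in [:: a; b; c]]; split.
- by move: aJ bJ cJ'; rewrite !inE => /and3P[_ _ ?] /and3P[_ _ ?] /and3P[_ _ ?]; apply: sub3.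
- by rewrite card_set3 // eq_sym.
- apply: (collinear_case (i := a) (k := b)); rewrite ?inE ?eqxx ?orbT ?nz //.
  by move=> s; rewrite !inE => /or3P[]/eqP->//; rewrite /cross mulrC subrr.
Qed.

(** * Groups with two generators: the induction *)

Lemma relations_det (G : zmodType) (f g : G) (a b c d : int) :
  f *~ a + g *~ b = 0 -> f *~ c + g *~ d = 0 ->
  f *~ (a * d - b * c) = 0 /\ g *~ (a * d - b * c) = 0.
Proof.
move=> r1 r2; split.
  have -> : f *~ (a * d - b * c) =
      (f *~ a + g *~ b) *~ d - (f *~ c + g *~ d) *~ b.
    rewrite !mulrzDl -!mulrzA mulrzBr [d * b]mulrC [c * b]mulrC opprD.
    by rewrite addrACA subrr addr0.
  by rewrite r1 r2 !mul0rz subr0.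
have -> : g *~ (a * d - b * c) =
    (f *~ c + g *~ d) *~ a - (f *~ a + g *~ b) *~ c.
  rewrite !mulrzDl -!mulrzA mulrzBr [d * a]mulrC [c * a]mulrC opprD.
  by rewrite addrACA subrr add0r.
by rewrite r1 r2 !mul0rz subr0.
Qed.

(** On [g], which a power of [p] kills, [b] acts invertibly. *)
Lemma generator_elim (G : zmodType) (k : nat) (f g : G) (a b : int) :
  f *~ a + g *~ b = 0 -> ~~ (p %| b)%Z -> g *~ (p%:Z ^+ k) = 0 ->
  exists e : int, g = f *~ e.
Proof.
move=> r pb gk; have [E [m [_ Em]]] := inverse_mod_pfactor k pb.
exists (- a * E); rewrite mulrzA mulrNz.
have -> : - (f *~ a) = g *~ b by apply/eqP; rewrite eq_sym -subr_eq0 opprK addrC r.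
by rewrite -mulrzA mulrC Em mulrzDr mulr1z mulrC mulrzA gk mul0rz addr0.
Qed.

(* The group generated by [f] and [g] is a quotient of [Z^2] by a lattice that
   contains the two relations, so its order divides [p ^ k]; passing to a
   subgroup of index [p] changes [f], [g] and the relations explicitly. *)
Lemma rank_two_case (I : finType) (G : zmodType) (n k : nat)
    (J : {set I}) (f g : G) (x y : I -> int) (a b c d : int) :
  (3 < n)%N || (n == 3) && (k <= 2)%N ->
  f *~ a + g *~ b = 0 -> f *~ c + g *~ d = 0 -> a * d - b * c = p%:Z ^+ k ->
  (n + k <= #|J|)%N ->
  exists T : {set I}, [/\ T \subset J, #|T| = n &
    weighted_zero T (fun r => f *~ x r + g *~ y r)].
Proof.
elim: k J f g x y a b c d => [|k IHk] J f g x y a b c d n_ge r1 r2 det nJ.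
  have [f0 g0] := relations_det r1 r2; rewrite det in f0 g0.
  have [|T [TJ cT wT]] := @cyclic_case I G n 0 f x J _ f0 nJ; first by lia.
  exists T; split=> //; apply: eq_weighted_zero wT => r _.
  by rewrite -[g]mulr1z g0 !mul0rz addr0.
have [fk gk] := relations_det r1 r2; rewrite det in fk gk.
have n_gt1 : (1 < n)%N by lia.
have g_cyclic e : g = f *~ e -> exists T : {set I},
    [/\ T \subset J, #|T| = n & weighted_zero T (fun r => f *~ x r + g *~ y r)].
  move=> ge.
  have [T [TJ cT wT]] :=
    cyclic_case (fun r => x r + e * y r) n_gt1 fk nJ.
  exists T; split=> //; apply: eq_weighted_zero wT => r _.
  by rewrite mulrzDr mulrzA -ge.
have f_cyclic e : f = g *~ e -> exists T : {set I},
    [/\ T \subset J, #|T| = n & weighted_zero T (fun r => f *~ x r + g *~ y r)].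
  move=> fe.
  have [T [TJ cT wT]] :=
    cyclic_case (fun r => e * x r + y r) n_gt1 gk nJ.
  exists T; split=> //; apply: eq_weighted_zero wT => r _.
  by rewrite mulrzDr mulrzA -fe.
(* A relation coefficient prime to [p] eliminates a generator and leaves a cyclic group; otherwise
   all four are multiples of [p]. *)
have [/dvdzP[b' def_b]|pb] := boolP (p %| b)%Z; last first.
  by have [e] := generator_elim r1 pb gk; apply: g_cyclic.
have [/dvdzP[d' def_d]|pd] := boolP (p %| d)%Z; last first.
  by have [e] := generator_elim r2 pd gk; apply: g_cyclic.
have [/dvdzP[a' def_a]|pa] := boolP (p %| a)%Z; last first.
  rewrite addrC in r1; have [e] := generator_elim r1 pa fk; exact: f_cyclic.
have [/dvdzP[c' def_c]|pc] := boolP (p %| c)%Z; last first.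
  rewrite addrC in r2; have [e] := generator_elim r2 pc fk; exact: f_cyclic.
have pn0 : p%:Z != 0 by lia.
have {}det : (a' * d' - b' * c') * p = p%:Z ^+ k.
  apply: (mulIf pn0); rewrite -exprSr -det def_a def_b def_c def_d; ring.
(* Now [p ^ 2] divides the determinant, so its exponent is at least [2]. *)
case: k => [|m] in IHk n_ge det nJ fk gk *.
  have := dvdz_mull (a' * d' - b' * c') (dvdzz p).
  by rewrite det dvdz_prime1.
have {}det : a' * d' - b' * c' = p%:Z ^+ m.
  by apply: (mulIf pn0); rewrite det exprSr.
(* The divided relations hold between [f *~ p] and [g *~ p] with determinant [p ^ m]. So congruences
   modulo [p ^ (m + 1)] suffice, although the determinant was [p ^ (m + 2)]. *)
have [fm gm] : f *~ (p%:Z ^+ m.+1) = 0 /\ g *~ (p%:Z ^+ m.+1) = 0.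
  have R (s t : int) : f *~ (s * p) + g *~ (t * p) = 0 ->
      f *~ p *~ s + g *~ p *~ t = 0.
    by rewrite -!mulrzA ![p%:Z * _]mulrC.
  have [||] := relations_det (R a' b' _) (R c' d' _).
  - by rewrite -def_a -def_b.
  - by rewrite -def_c -def_d.
  by rewrite det -!mulrzA -exprS.
have n_ge' : (3 < n)%N || (n == 3) && (m.+1 <= 2)%N by lia.
(* Vectors on the line [x = 0]: pass to the generators [f *~ p] and [g], dividing the first column
   of the relations by [p]. *)
have x_step (J' : {set I}) : J' \subset J -> (n + m.+1 <= #|J'|)%N ->
    (forall r, r \in J' -> (p %| x r)%Z) -> exists T : {set I},
    [/\ T \subset J, #|T| = n & weighted_zero T (fun r => f *~ x r + g *~ y r)].
  move=> J'J cJ' px.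
  have [|||T [TJ' cT wT]] := IHk J' (f *~ p) g (fun r => x r %/ p)%Z y
    a' b c' d n_ge' _ _ _ cJ'.
  - by rewrite -mulrzA mulrC -def_a.
  - by rewrite -mulrzA mulrC -def_c.
  - by rewrite exprS -det def_b def_d; ring.
  exists T; split=> //; first exact: subset_trans TJ' J'J.
  apply: eq_weighted_zero wT => r /(subsetP TJ')/px/divzK pxr.
  by rewrite -mulrzA mulrC pxr.
(* Vectors on the line [y = e * x]: pass to the generators [f + g *~ e] and [g *~ p]. *)
have slope_step (J' : {set I}) (e : int) : J' \subset J ->
    (n + m.+1 <= #|J'|)%N ->
    (forall r, r \in J' -> (p %| y r - e * x r)%Z) -> exists T : {set I},
    [/\ T \subset J, #|T| = n & weighted_zero T (fun r => f *~ x r + g *~ y r)].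
  move=> J'J cJ' py.
  have rel (s t : int) : f *~ (s * p) + g *~ (t * p) = 0 ->
      (f + g *~ e) *~ (s * p) + g *~ p *~ (t - e * s) = 0.
    move=> <-; rewrite mulrzDl -addrA -!mulrzA -mulrzDr.
    by congr (_ + _ *~ _); ring.
  have [|||T [TJ' cT wT]] := IHk J' (f + g *~ e) (g *~ p) x
    (fun r => (y r - e * x r) %/ p)%Z
    a (b' - e * a') c (d' - e * c') n_ge' _ _ _ cJ'.
  - by rewrite def_a rel // -def_a -def_b.
  - by rewrite def_c rel // -def_c -def_d.
  - by rewrite exprS -det def_a def_c; ring.
  exists T; split=> //; first exact: subset_trans TJ' J'J.
  apply: eq_weighted_zero wT => r /(subsetP TJ')/py/divzK pyr.
  rewrite mulrzDl -!mulrzA [p%:Z * _]mulrC pyr -addrA -mulrzDr.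
  by congr (_ + _ *~ _); ring.
have line_step i : i \in J -> nonzero_mod x y i ->
    (n + m.+1 <= #|[set r in J | p %| cross x y r i]%Z|)%N -> exists T : {set I},
    [/\ T \subset J, #|T| = n & weighted_zero T (fun r => f *~ x r + g *~ y r)].
  move=> iJ nzi cJ'.
  set J' := [set r in J | _] in cJ'.
  have J'J : J' \subset J by apply/subsetP=> r; rewrite inE => /andP[].
  have [xi|xi] := boolP (p %| x i)%Z.
    apply: (x_step J' J'J cJ') => r; rewrite inE => /andP[_ ri].
    have : (p %| x r * y i)%Z.
      have -> : x r * y i = cross x y r i + y r * x i by rewrite /cross; ring.
      by rewrite rpredD // dvdz_mull.
    by move: nzi; rewrite dvdz_primeM /nonzero_mod xi /= => /negPf->; rewrite orbF.
  (* [E] inverts [x i] modulo [p], so the line through [i] has slope [E * y i]. *)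
  have [E [q []]] := inverse_mod_pfactor 1 xi; rewrite expr1 => _ Eq.
  apply: (slope_step J' (E * y i) J'J cJ') => r; rewrite inE => /andP[_ ri].
  have -> : y r - E * y i * x r = y r * (1 - E * x i) - E * cross x y r i.
    by rewrite /cross; ring.
  by rewrite Eq rpredB ?dvdz_mull // opprD addNKr rpredN dvdz_mull.
have wz T : sum_zero_mod (p%:Z ^+ m.+1) x y T ->
  weighted_zero T (fun r => f *~ x r + g *~ y r).
  exact: sum_zero_mod_weighted_zero.
have off_line i : i \in J -> nonzero_mod x y i ->
    ~~ (n + m.+1 <= #|[set r in J | p %| cross x y r i]%Z|)%N ->
    exists j l : I, [/\ j \in J, l \in J, j != l,
      ~~ (p %| cross x y j i)%Z & ~~ (p %| cross x y l i)%Z].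
  move=> iJ nzi cJ'; set J' := [set r in J | _] in cJ'.
  have J'J : J' \subset J by apply/subsetP=> r; rewrite inE => /andP[].
  have : (1 < #|J :\: J'|)%N.
    by move: nJ cJ'; rewrite -(cardsID J' J) (setIidPr J'J); lia.
  case/card_gt1P=> j [l [jJ lJ jl]]; exists j, l.
  move: jJ lJ; rewrite !inE !negb_and => /andP[+ jJ] /andP[+ lJ].
  by rewrite jJ lJ.
have [/existsP[i /and3P[iJ nzi]]|] := boolP [exists i, [&& i \in J,
    nonzero_mod x y i & (n + m.+1 <= #|[set r in J | p %| cross x y r i]%Z|)%N]].
  exact: line_step.
move=> /existsPn no_line.
have {}off_line i : i \in J -> nonzero_mod x y i ->
    exists j l : I, [/\ j \in J, l \in J, j != l,
      ~~ (p %| cross x y j i)%Z & ~~ (p %| cross x y l i)%Z].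
  by move=> iJ nzi; apply: off_line => //; have := no_line i; rewrite iJ nzi.
have [/existsP[i /andP[iJ nzi]]|zero] :=
    boolP [exists i, (i \in J) && nonzero_mod x y i]; last first.
  apply: (x_step J) => [//||r rJ]; first by lia.
  move/existsPn/(_ r): zero; rewrite rJ negbK => /andP[].
  by [].
have [/existsP[i1 /existsP[k1]]|np] := boolP [exists i1, exists k1,
    [&& i1 \in J, k1 \in J, i1 != k1, nonzero_mod x y i1, nonzero_mod x y k1
      & p %| cross x y k1 i1]%Z].
  case/and5P=> i1J k1J ik1 nzi1 /andP[nzk1 ki1].
  have [n_gt3|n_le3] := ltnP 3 n.
    have [j [l [jJ lJ jl ji li]]] := off_line _ i1J nzi1.
    have [|T [TJ cT sT]] := parallel_pair_case (n := n) m _ i1J jJ k1J lJ ik1 jl nzk1 ki1 ji li.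
      by rewrite n_gt3; lia.
    by exists T; split=> //; apply: wz.
  (* For [n = 3] only determinant [p ^ 2] remains, so the congruences are modulo [p]. *)
  have [n3 m0] : n = 3 /\ m = 0 by lia.
  have [|T [TJ cT sT]] := parallel_pair_case3 _ i1J k1J ik1 nzi1 nzk1 ki1.
    by lia.
  by exists T; split; rewrite ?n3 //; apply: wz; rewrite m0.
have [j [l [jJ lJ jl ji li]]] := off_line _ iJ nzi.
have Jnp : {in J &, forall r s, r != s -> nonzero_mod x y r ->
    nonzero_mod x y s -> ~~ (p %| cross x y r s)%Z}.
  move=> r s rJ sJ rs nzr nzs; move/existsPn/(_ s)/existsPn/(_ r): np.
  by rewrite sJ rJ eq_sym rs nzs nzr.
have lj : ~~ (p %| cross x y l j)%Z.
  by rewrite Jnp // ?(eq_sym l) // (nonzero_cross ji, nonzero_cross li).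
have ij : ~~ (p %| cross x y i j)%Z by rewrite cross_dvd_sym.
have [||T [TJ cT sT]] := nonparallel_case (n := n) m _ _ iJ jJ lJ ij li lj Jnp.
- by lia.
- by lia.
by exists T; split=> //; apply: wz.
Qed.

End UnitWeights.

(** * From weights on indices to weighted subsequences *)

Lemma sum_nth_map (I : Type) (G : zmodType) (h : I -> G) (w : I -> int)
    (e : seq I) :
  \sum_(j < size [seq h i | i <- e]) [seq h i | i <- e]`_j *~ [seq w i | i <- e]`_j =
  \sum_(i <- e) h i *~ w i.
Proof.
elim: e => [|i e IHe]; first by rewrite big_ord0 big_nil.
by rewrite big_cons big_ord_recl /= -IHe.
Qed.

Lemma coprime_weights_prime (p n : nat) (a : int) :
  prime p -> (0 < n)%N ->
  (a \in coprime_weights p (p ^ n)) =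
  [&& 1 <= a, a <= (p ^ n)%:Z & ~~ (p %| a)%Z].
Proof.
move=> p_pr n_gt0; rewrite inE -andbA.
by rewrite coprimez_sym coprimezE prime_coprime.
Qed.

(** Weights may be reduced modulo [p ^ n], which kills [G]; being prime to [p], they stay nonzero
    and land between [1] and [p ^ n]. *)
Lemma weighted_zero_subseq (p n : nat) (G : zmodType) (s : seq G)
    (T : {set 'I_(size s)}) :
  prime p -> (0 < n)%N -> (forall g : G, g *+ (p ^ n) = 0) ->
  weighted_zero p T (fun i => s`_i) ->
  exists t : seq G, [/\ subseq t s, size t = #|T| &
    weighted_zero_sum (coprime_weights p (p ^ n)) t].
Proof.
move=> p_pr n_gt0 Gpn [u uP u0].
pose w i := (u i %% (p ^ n)%N)%Z.
exists [seq s`_(i : 'I_(size s)) | i <- enum T]; split.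
- have def_s : [seq s`_(i : 'I_(size s)) | i <- enum 'I_(size s)] = s.
    by rewrite -[RHS](mkseq_nth 0) /mkseq -val_enum_ord -map_comp.
  rewrite -[X in subseq _ X]def_s map_subseq // [enum 'I__]enumT.
  exact: filter_subseq.
- by rewrite size_map -cardE.
- exists (fun j => [seq w i | i <- enum T]`_j); split.
    move=> j; have : [seq w i | i <- enum T]`_j \in [seq w i | i <- enum T].
      by apply: mem_nth; case: j => j; rewrite !size_map.
    case/mapP=> i _ ->; rewrite coprime_weights_prime //.
    have pw : ~~ (p %| w i)%Z.
      apply: contraNN (uP i); rewrite (divz_eq (u i) (p ^ n)%N) => pw.
      by rewrite rpredD // dvdz_mull // dvdzE /= dvdn_exp.
    have q_gt0 : (0 < p ^ n)%N by rewrite expn_gt0 prime_gt0.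
    have q0 : (p ^ n)%N != 0 :> int by rewrite eqz_nat -lt0n.
    rewrite pw (ltW (ltz_pmod _ _)) ?ltz_nat // !andbT.
    rewrite -gtz0_ge1 lt0r modz_ge0 // andbT.
    by apply: contraNneq pw => ->; rewrite dvdz0.
  rewrite sum_nth_map big_enum -[RHS]u0; apply: eq_bigr => i _.
  rewrite /w /modz mulrzBr [_ * Posz _]mulrC mulrzA -pmulrn.
  by rewrite Gpn mul0rz subr0.
Qed.

(** * Exponents, and powers of [p] in cyclic factors *)

Lemma exponent_zmod (G : finZmodType) (N : nat) :
  (forall g : G, g *+ N = 0) ->
  (forall m, (forall g : G, g *+ m = 0) -> (N %| m)%N) ->
  exponent [set: G] = N.
Proof.
move=> GN minN; apply/eqP; rewrite eqn_dvd; apply/andP; split.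
  by apply/exponentP=> g _; rewrite FinRing.zmodXgE GN.
apply: minN => g; rewrite -FinRing.zmodXgE.
by apply: (exponentP (dvdnn _)); rewrite inE.
Qed.

Lemma natr_Zp_eq0 (q m : nat) : (1 < q)%N -> (m%:R == 0 :> 'Z_q) = (q %| m)%N.
Proof. by move=> q_gt1; rewrite -val_eqE /= val_Zp_nat. Qed.

Lemma intr_Zp_eq0 (q : nat) (m : int) :
  (1 < q)%N -> (m%:~R == 0 :> 'Z_q) = (q %| m)%Z.
Proof.
move=> q_gt1; case: m => m; first by rewrite -pmulrn natr_Zp_eq0.
by rewrite NegzE mulrNz oppr_eq0 -pmulrn natr_Zp_eq0 // rpredN.
Qed.

Lemma pfactor_gt1 (p a : nat) : prime p -> (0 < a)%N -> (1 < p ^ a)%N.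
Proof. by move=> p_pr a_gt0; rewrite -(exp1n a) ltn_exp2r // prime_gt1. Qed.

Lemma pfactor_Zp_inj (p a i j : nat) : prime p -> (i < a)%N -> (j < a)%N ->
  (p ^ i)%:R = (p ^ j)%:R :> 'Z_(p ^ a) -> i = j.
Proof.
move=> p_pr ia ja /(congr1 val); have p_gt1 := prime_gt1 p_pr.
have q_gt1 : (1 < p ^ a)%N by apply: pfactor_gt1 => //; apply: leq_ltn_trans ia.
by rewrite /= !val_Zp_nat // !modn_small ?ltn_exp2l // => /eqP; rewrite eqn_exp2l // => /eqP.
Qed.

Lemma pfactor_Zp_neq0 (p a i : nat) : prime p -> (i < a)%N ->
  (p ^ i)%:R != 0 :> 'Z_(p ^ a).
Proof.
move=> p_pr ia; have a_gt0 : (0 < a)%N by apply: leq_ltn_trans ia.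
by rewrite natr_Zp_eq0 ?pfactor_gt1 // dvdn_Pexp2l ?prime_gt1 // -ltnNge.
Qed.

(* After multiplication by a suitable power of [p] only the term of least
   valuation survives. *)
Lemma distinct_pfactors_independent (p a : nat) (I : finType)
    (z : I -> 'Z_(p ^ a)) (u : I -> int) :
  prime p -> (0 < a)%N -> unit_weights p u ->
  (forall i, z i != 0 -> exists2 e, (e < a)%N & z i = (p ^ e)%:R) ->
  (forall i j, z i != 0 -> z i = z j -> i = j) ->
  \sum_i z i *~ u i = 0 -> forall i, z i = 0.
Proof.
move=> p_pr a_gt0 uP zpow zinj sum0 i; apply/eqP/negPn/negP=> zi.
have q_gt1 := pfactor_gt1 p_pr a_gt0.
pose E e := (e < a)%N && [exists i, z i == (p ^ e)%:R].
have exE : exists e, E e.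
  have [e ea zie] := zpow i zi.
  by exists e; rewrite /E ea; apply/existsP; exists i; rewrite zie.
have [e /andP[ea /existsP[i0 /eqP zi0]] e_min] := ex_minnP exE.
have zi0n0 : z i0 != 0 by rewrite zi0 pfactor_Zp_neq0.
(* The exponent [e] is least and, by [zinj], attained only at [i0], so every other term becomes a
   multiple of [p ^ a]. *)
have scaled r : z r *~ u r * (p ^ (a - e.+1))%:R =
    if r == i0 then (p ^ a.-1)%:R *~ u i0 else 0.
  case: eqP => [->|/eqP r_i0].
    rewrite zi0 mulrzAl -natrM -expnD; congr ((p ^ _)%:R *~ _); lia.
  have [->|zr] := eqVneq (z r) 0; first by rewrite mul0rz mul0r.
  have [e' e'a zre'] := zpow r zr.
  have e_e' : (e < e')%N.
    rewrite ltn_neqAle e_min ?andbT.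
      apply: contraNneq r_i0 => ee'; apply/eqP/zinj => //.
      by rewrite zre' zi0 ee'.
    by rewrite /E e'a; apply/existsP; exists r; rewrite zre'.
  rewrite zre' mulrzAl -natrM -expnD; apply/eqP.
  have /eqP-> : (p ^ (e' + (a - e.+1)))%:R == 0 :> 'Z_(p ^ a).
    by rewrite natr_Zp_eq0 // dvdn_exp2l //; lia.
  by rewrite mul0rz.
have : (\sum_r z r *~ u r) * (p ^ (a - e.+1))%:R = 0 by rewrite sum0 mul0r.
rewrite mulr_suml (eq_bigr _ (fun r _ => scaled r)) -big_mkcond big_pred1_eq.
move=> /eqP; rewrite pmulrn -mulrzA intr_Zp_eq0 //.
have -> : (p ^ a = p ^ a.-1 * p)%N by rewrite -expnSr prednK.
rewrite PoszM dvdz_mul2l.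
  by rewrite (negPf (uP i0)).
by rewrite eqz_nat -lt0n expn_gt0 prime_gt0.
Qed.

(** Zeros may repeat in the sequences below; only a nonzero value determines its position. *)
Lemma nth_inj_of_uniq_filter (T : eqType) (x0 : T) (P : pred T) (t : seq T) i j :
  uniq (filter P t) -> (i < size t)%N -> (j < size t)%N -> P (nth x0 t i) ->
  nth x0 t i = nth x0 t j -> i = j.
Proof.
elim: t i j => [|x t IHt] // [|i] [|j] //= t_uniq.
- move=> _ jt Px xj; move: t_uniq; rewrite Px /= mem_filter Px /=.
  by rewrite xj mem_nth.
- move=> it _ Pi ix; move: t_uniq; rewrite -ix Pi /= mem_filter Pi /=.
  by rewrite mem_nth.
- move=> it jt Pi /IHt-> //; move: t_uniq; case: (P x) => //= /andP[] //.
Qed.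

Lemma Zp_prod_mulrn (p a b : nat) (g : 'Z_(p ^ a) * 'Z_(p ^ b)) :
  prime p -> (0 < b)%N -> (b <= a)%N -> g *+ (p ^ a) = 0.
Proof.
move=> p_pr b_gt0 ba; have a_gt0 := leq_trans b_gt0 ba.
have Zp_mulrn q (z : 'Z_q) N : (1 < q)%N -> (q %| N)%N -> z *+ N = 0.
  move=> q_gt1 qN; rewrite -mulr_natr.
  by have /eqP-> := etrans (natr_Zp_eq0 N q_gt1) qN; rewrite mulr0.
by rewrite pairMnE !Zp_mulrn ?pfactor_gt1 // dvdn_exp2l.
Qed.

Lemma exponent_Zp_prod (p a b : nat) :
  prime p -> (0 < b)%N -> (b <= a)%N ->
  exponent [set: ('Z_(p ^ a) * 'Z_(p ^ b))%type : finZmodType] = (p ^ a)%N.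
Proof.
move=> p_pr b_gt0 ba; have a_gt0 := leq_trans b_gt0 ba.
apply: exponent_zmod => [g|m Gm]; first exact: Zp_prod_mulrn.
have /(congr1 fst)/eqP := Gm (1, 0).
by rewrite pairMnE /= natr_Zp_eq0 // pfactor_gt1.
Qed.

(** * The extremal sequence *)

(** Its length is [p ^ a + a + b - 1], and it has one zero too few for a zero sum made of zeros
    alone. *)
Definition extremal_seq (p a b : nat) : seq ('Z_(p ^ a) * 'Z_(p ^ b)) :=
  nseq (p ^ a).-1 0 ++ [seq ((p ^ i)%:R, 0) | i <- iota 0 a]
    ++ [seq (0, (p ^ j)%:R) | j <- iota 0 b].

Lemma mem_extremal_seq (p a b : nat) z : z \in extremal_seq p a b ->
  [\/ z = 0, exists2 i, (i < a)%N & z = ((p ^ i)%:R, 0) |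
      exists2 j, (j < b)%N & z = (0, (p ^ j)%:R)].
Proof.
rewrite !mem_cat mem_nseq => /or3P[/andP[_ /eqP->]|/mapP[i]|/mapP[j]].
- exact: Or31.
- by rewrite mem_iota => ia ->; apply: Or32; exists i.
- by rewrite mem_iota => jb ->; apply: Or33; exists j.
Qed.

Lemma extremal_seq_filter (p a b : nat) : prime p ->
  let s := [seq z <- extremal_seq p a b | z != 0] in
  uniq s /\ size s = (a + b)%N.
Proof.
move=> p_pr; rewrite /extremal_seq filter_cat.
set r := map _ _ ++ map _ _.
have r_uniq : uniq r.
  rewrite cat_uniq; apply/and3P; split.
  - rewrite map_inj_in_uniq ?iota_uniq // => i j; rewrite !mem_iota => ia ja.
    by move=> /(congr1 fst)/(pfactor_Zp_inj p_pr ia ja).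
  - apply/hasPn=> _ /mapP[j + ->]; rewrite mem_iota => jb.
    apply/mapP=> -[i _ /(congr1 snd)/= /eqP].
    by rewrite (negPf (pfactor_Zp_neq0 p_pr jb)).
  - rewrite map_inj_in_uniq ?iota_uniq // => i j; rewrite !mem_iota => ib jb.
    by move=> /(congr1 snd)/(pfactor_Zp_inj p_pr ib jb).
have r_neq0 : all (fun z => z != 0) r.
  rewrite all_cat; apply/andP; split; apply/allP=> _ /mapP[i + ->].
    rewrite mem_iota => ia.
    by apply: contraNneq (pfactor_Zp_neq0 p_pr ia) => /(congr1 fst)/= ->.
  rewrite mem_iota => ib.
  by apply: contraNneq (pfactor_Zp_neq0 p_pr ib) => /(congr1 snd)/= ->.
rewrite (all_filterP r_neq0) (_ : [seq z <- nseq _ _ | _] = [::]) /=.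
  by rewrite r_uniq size_cat !size_map !size_iota.
by apply/eqP; rewrite -[_ == _]negbK -has_filter has_nseq eqxx andbF.
Qed.

(** The nonzero first coordinates of [t] are distinct powers of [p], hence independent, so a zero
    sum leaves none; likewise for the second ones. Then [t] consists of [p ^ a] zeros, one more than
    available. *)
Lemma extremal_seq_no_zero_sum (p a b : nat) (t : seq ('Z_(p ^ a) * 'Z_(p ^ b))) :
  prime p -> (0 < a)%N -> (0 < b)%N -> subseq t (extremal_seq p a b) ->
  size t = (p ^ a)%N -> ~ weighted_zero_sum (coprime_weights p (p ^ a)) t.
Proof.
move=> p_pr a_gt0 b_gt0 ts size_t [u [uA u0]].
have [s_uniq size_s] := extremal_seq_filter a b p_pr.
have uP : unit_weights p u.
  by move=> i; move: (uA i); rewrite coprime_weights_prime // => /and3P[].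
have t_uniq : uniq [seq z <- t | z != 0].
  apply: subseq_uniq s_uniq.
  by rewrite subseq_filter filter_all (subseq_trans (filter_subseq _ _) ts).
have t_inj (i j : 'I_(size t)) : t`_i != 0 -> t`_i = t`_j -> i = j.
  move=> ti tij; apply/val_inj.
  exact: (nth_inj_of_uniq_filter t_uniq (ltn_ord i) (ltn_ord j) ti tij).
have t_mem (i : 'I_(size t)) := mem_extremal_seq (mem_subseq ts (mem_nth 0 (ltn_ord i))).
have t1 : forall i : 'I_(size t), (t`_i).1 = 0.
  apply: (distinct_pfactors_independent (z := fun j : 'I_(size t) => (t`_j).1) p_pr a_gt0 uP).
  - move=> j; case: (t_mem j) => [->|[e ea ->]|[e eb ->]]; rewrite ?eqxx //.
    by exists e.
  - move=> j k tj tjk; apply: t_inj; first by apply: contraNneq tj => ->.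
    (* A nonzero first coordinate forces the second to be [0], so equal nonzero first coordinates
       mean equal entries. *)
    case: (t_mem j) tj tjk => [->|[e ea ->]|[e eb ->]]; rewrite ?eqxx //.
    move=> + tjk; move: tjk.
    by case: (t_mem k) => [->|[e' ea' ->]|[e' eb' ->]] /= ->; rewrite ?eqxx.
  - move/(congr1 fst): u0; rewrite raddf_sum /= => u0; rewrite -[RHS]u0.
    by apply: eq_bigr => j _; rewrite raddfMz.
have t2 : forall i : 'I_(size t), (t`_i).2 = 0.
  apply: (distinct_pfactors_independent (z := fun j : 'I_(size t) => (t`_j).2) p_pr b_gt0 uP).
  - move=> j; case: (t_mem j) => [->|[e ea ->]|[e eb ->]]; rewrite ?eqxx //.
    by exists e.
  - move=> j k tj tjk; apply: t_inj; first by apply: contraNneq tj => ->.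
    case: (t_mem j) tj tjk => [->|[e ea ->]|[e eb ->]]; rewrite ?eqxx //.
    move=> + tjk; move: tjk.
    by case: (t_mem k) => [->|[e' ea' ->]|[e' eb' ->]] /= ->; rewrite ?eqxx.
  - move/(congr1 snd): u0; rewrite raddf_sum /= => u0; rewrite -[RHS]u0.
    by apply: eq_bigr => j _; rewrite raddfMz.
have t0 : count_mem 0 t = size t.
  apply/eqP; rewrite -all_count; apply/(all_nthP 0) => i it.
  apply/eqP; have := (t1 (Ordinal it), t2 (Ordinal it)).
  by case: (t`_i) => z1 z2 /= [-> ->].
have := leq_count_subseq (pred1 0) ts; rewrite t0 size_t leqNgt => /negP[].
have := count_predC (pred1 0) (extremal_seq p a b).
rewrite -(size_filter (predC _)) size_s !size_cat size_nseq !size_map !size_iota.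
have : (0 < p ^ a)%N by rewrite expn_gt0 prime_gt0.
lia.
Qed.

(** * The two bounds *)

Lemma zero_sum_subseq_exists (p a b : nat) :
  prime p -> odd p -> (0 < b)%N -> (b <= a)%N ->
  has_weighted_zero_sum_subseq ('Z_(p ^ a) * 'Z_(p ^ b))%type
    (coprime_weights p (p ^ a)) (p ^ a + a + b).
Proof.
move=> p_pr p_odd b_gt0 ba s size_s; have a_gt0 := leq_trans b_gt0 ba.
rewrite exponent_Zp_prod //.
have Gexp (g : 'Z_(p ^ a) * 'Z_(p ^ b)) : g *+ (p ^ a) = 0.
  exact: Zp_prod_mulrn.
pose x (i : 'I_(size s)) : int := val (s`_i).1.
pose y (i : 'I_(size s)) : int := val (s`_i).2.
(* Standard generators; the relation matrix is diagonal with entries [p ^ a] and [p ^ b], of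
   determinant [p ^ (a + b)]. *)
have [|||||T [_ cT wT]] := @rank_two_case p p_pr p_odd 'I_(size s)
  ('Z_(p ^ a) * 'Z_(p ^ b))%type (p ^ a) (a + b) setT
  (1, 0) (0, 1) x y (p ^ a)%N 0 0 (p ^ b)%N.
(* [p ^ a <= 3] forces [p = 3] and [a = b = 1], the exceptional case with [n = 3] and [k = 2]. *)
- have p_gt2 := odd_prime_gt2 p_odd p_pr.
  have [//|/= q_le3] := ltnP 3 (p ^ a).
  have [a_gt1|a_le1] := ltnP 1 a.
    have : (p ^ 2 <= p ^ a)%N by rewrite leq_pexp2l // prime_gt0.
    by nia.
  have a1 : a = 1 by lia.
  by move: q_le3; rewrite a1 expn1 => q_le3; apply/andP; split; lia.
- by rewrite mulr0z addr0 -pmulrn Gexp.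
- rewrite mulr0z add0r -pmulrn pairMnE mul0rn; congr (_, _); apply/eqP.
  by rewrite natr_Zp_eq0 // pfactor_gt1.
- by rewrite mulr0 subr0 -PoszM -expnD -natz natrX natz.
- by rewrite cardsT card_ord addnA.
have [|t [ts size_t wt]] := @weighted_zero_subseq p a _ s T p_pr a_gt0 Gexp.
  apply: eq_weighted_zero wT => i _.
  rewrite /x /y -!pmulrn !pairMnE !mul0rn.
  by case: (s`_i) => z1 z2; rewrite /= !natr_Zp; apply: (congr2 pair (addr0 _) (add0r _)).
by exists t; rewrite size_t.
Qed.

Lemma zero_sum_length_ge (p a b m : nat) :
  prime p -> (0 < b)%N -> (b <= a)%N ->
  has_weighted_zero_sum_subseq ('Z_(p ^ a) * 'Z_(p ^ b))%type
    (coprime_weights p (p ^ a)) m ->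
  (p ^ a + a + b <= m)%N.
Proof.
move=> p_pr b_gt0 ba Hm; have a_gt0 := leq_trans b_gt0 ba.
rewrite leqNgt; apply/negP=> m_lt.
have [|t [ts size_t]] := Hm (extremal_seq p a b); last first.
  by apply: extremal_seq_no_zero_sum => //; rewrite size_t exponent_Zp_prod.
rewrite !size_cat size_nseq !size_map !size_iota.
have : (0 < p ^ a)%N by rewrite expn_gt0 prime_gt0.
lia.
Qed.

Local Close Scope ring_scope.

Theorem theorem4p5 (p alpha beta : nat) :
  prime p -> odd p -> 0 < beta -> beta <= alpha ->
  is_s ('Z_(p ^ alpha) * 'Z_(p ^ beta))%type
       (coprime_weights p (p ^ alpha)) (p ^ alpha + alpha + beta).
Proof.
move=> p_pr p_odd b_gt0 ba; split; first exact: zero_sum_subseq_exists.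
by move=> m; apply: zero_sum_length_ge.
Qed.
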